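(* Let $(N,M,(v_i)_{i\in N})$ be an unconstrained fair allocation instance with $N=[n]$ and $M$ finite, both non-empty, and additive nonnegative valuations. Let $M'$ be a set of dummy goods, disjoint from $M$, of size $|M|\cdot(|N|-1)$, and let $v_i'(X)=v_i(X\cap M)$ for each $i\in N$ and $X\subseteq M\cup M'$. Consider the balanced instance $(N,M\cup M',(v'_i)_{i\in N})$, in which each agent must receive exactly $|M\cup M'|/|N|$ goods. Then the following hold. (1) If an allocation $A=(A_1,\dots,A_n)$ is PO (resp. fPO, EF1) in the unconstrained instance, then every balanced allocation of the form $(A_1\cup D_1,\dots,A_n\cup D_n)$, where $(D_1,\dots,D_n)$ is an ordered partition of $M'$, is PO (resp. fPO, EF1) in the balanced instance. (2) If a balanced allocation $A'=(A'_1,\dots,A'_n)$ is PO (resp. fPO, EF1) in the balanced instance, then the allocation $(A'_1\cap M,\dots,A'_n\cap M)$ is PO (resp. fPO, EF1) in the unconstrained instance.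
   Context: Each agent $i$ has values $v_{ij}\ge 0$ and $v_i(X)=\sum_{j\in X}v_{ij}$. An allocation of a set of goods $G$ is an ordered partition $(A_1,\dots,A_n)$ of $G$ (parts may be empty); it is balanced if all parts have the same size $|G|/n$. A fractional allocation of $G$ is a matrix $x\in\mathbb{R}_{\ge 0}^{N\times G}$ with $\sum_{i\in N}x_{ij}=1$ for all $j\in G$; it is balanced if additionally $\sum_{j\in G}x_{ij}=|G|/n$ for all $i\in N$. Integral allocations are identified with $0/1$ matrices. EF1: for all $i,i'\in N$ either $A_{i'}=\emptyset$ or there is $j\in A_{i'}$ such that agent $i$'s value for $A_i$ is at least agent $i$'s value for $A_{i'}\setminus\{j\}$. A (fractional) allocation $x$ Pareto-dominates $x'$ if every agent's value (agent $i$ with values $w_{ij}$ gets $\sum_j w_{ij}x_{ij}$) is at least as large under $x$ as under $x'$, and strictly larger for some agent. In the unconstrained instance, an allocation is PO (resp. fPO) if it is not Pareto-dominated by any allocation (resp. any fractional allocation). In the balanced instance, a balanced allocation is PO (resp. fPO) if it is not Pareto-dominated by any balanced allocation (resp. any balanced fractional allocation). *)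

(* Defs.v *)
From HB Require Import structures.
From mathcomp Require Import all_boot all_order all_algebra.

Set Implicit Arguments.
Unset Strict Implicit.
Unset Printing Implicit Defensive.

Import Order.TTheory GRing.Theory Num.Theory.
Local Open Scope ring_scope.

(* Agents are the elements of 'I_n. Goods live in an ambient finite type T and
   an instance is given by the set G : {set T} of its goods; values w i j and
   matrix entries x i j at goods j outside G are never looked at. *)

Definition value (R : realFieldType) (n : nat) (T : finType)
    (w : 'I_n -> T -> R) (i : 'I_n) (X : {set T}) : R :=
  \sum_(j in X) w i j.

Definition allocation (n : nat) (T : finType) (G : {set T})
    (A : 'I_n -> {set T}) : Prop :=
  \bigcup_(i < n) A i = G /\
  (forall i i' : 'I_n, i != i' -> [disjoint A i & A i']).

(* #|A i| = #|G| / n, written without truncated division. *)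
Definition balanced_allocation (n : nat) (T : finType) (G : {set T})
    (A : 'I_n -> {set T}) : Prop :=
  allocation G A /\ (forall i : 'I_n, (n * #|A i|)%N = #|G|).

Definition frac_allocation (R : realFieldType) (n : nat) (T : finType)
    (G : {set T}) (x : 'I_n -> T -> R) : Prop :=
  (forall (i : 'I_n) (j : T), j \in G -> 0 <= x i j) /\
  (forall j : T, j \in G -> \sum_(i < n) x i j = 1).

Definition balanced_frac_allocation (R : realFieldType) (n : nat) (T : finType)
    (G : {set T}) (x : 'I_n -> T -> R) : Prop :=
  frac_allocation G x /\
  (forall i : 'I_n, \sum_(j in G) x i j = #|G|%:R / n%:R).

Definition matrix_of (R : realFieldType) (n : nat) (T : finType)
    (A : 'I_n -> {set T}) (i : 'I_n) (j : T) : R :=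
  (j \in A i)%:R.

Definition frac_value (R : realFieldType) (n : nat) (T : finType) (G : {set T})
    (w x : 'I_n -> T -> R) (i : 'I_n) : R :=
  \sum_(j in G) w i j * x i j.

Definition dominates (R : realFieldType) (n : nat) (T : finType) (G : {set T})
    (w x x' : 'I_n -> T -> R) : Prop :=
  (forall i : 'I_n, frac_value G w x' i <= frac_value G w x i) /\
  (exists i : 'I_n, frac_value G w x' i < frac_value G w x i).

Definition EF1 (R : realFieldType) (n : nat) (T : finType)
    (w : 'I_n -> T -> R) (A : 'I_n -> {set T}) : Prop :=
  forall i i' : 'I_n,
    A i' = set0 \/
    (exists2 j : T, j \in A i' & value w i (A i' :\ j) <= value w i (A i)).

Definition PO (R : realFieldType) (n : nat) (T : finType) (G : {set T})
    (w : 'I_n -> T -> R) (A : 'I_n -> {set T}) : Prop :=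
  ~ (exists B : 'I_n -> {set T},
       allocation G B /\ dominates G w (matrix_of R B) (matrix_of R A)).

Definition fPO (R : realFieldType) (n : nat) (T : finType) (G : {set T})
    (w : 'I_n -> T -> R) (A : 'I_n -> {set T}) : Prop :=
  ~ (exists x : 'I_n -> T -> R,
       frac_allocation G x /\ dominates G w x (matrix_of R A)).

Definition balanced_PO (R : realFieldType) (n : nat) (T : finType)
    (G : {set T}) (w : 'I_n -> T -> R) (A : 'I_n -> {set T}) : Prop :=
  ~ (exists B : 'I_n -> {set T},
       balanced_allocation G B /\
       dominates G w (matrix_of R B) (matrix_of R A)).

Definition balanced_fPO (R : realFieldType) (n : nat) (T : finType)
    (G : {set T}) (w : 'I_n -> T -> R) (A : 'I_n -> {set T}) : Prop :=
  ~ (exists x : 'I_n -> T -> R,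
       balanced_frac_allocation G x /\ dominates G w x (matrix_of R A)).

(* Main.v *)
(** Dummy goods have value zero, so the value of a (fractional) allocation of
    [M :|: M'] only depends on its restriction to [M]. Restricting to [M] sends
    balanced (fractional) allocations to (fractional) allocations; conversely no
    agent gets more than [#|M|] goods of [M], and there are exactly enough dummy
    goods to top every agent up to [#|M|] goods. Hence Pareto improvements
    transfer in both directions. For EF1, removing a dummy good changes nothing,
    and removing instead a good of [M] only helps. *)
Require Import Defs.
From HB Require Import structures.
From mathcomp Require Import all_boot all_order all_algebra.

Set Implicit Arguments.
Unset Strict Implicit.
Unset Printing Implicit Defensive.

Import Order.TTheory GRing.Theory Num.Theory.
Local Open Scope ring_scope.

Lemma card_allocation (n : nat) (T : finType) (G : {set T})
    (A : 'I_n -> {set T}) :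
  allocation G A -> (\sum_(i < n) #|A i|)%N = #|G|.
Proof.
case=> <- dA; rewrite -sum1_card partition_disjoint_bigcup //=.
by apply: eq_bigr => i _; rewrite sum1_card.
Qed.

Lemma allocationI (n : nat) (T : finType) (G M : {set T})
    (A : 'I_n -> {set T}) :
  M \subset G -> allocation G A -> allocation M (fun i => A i :&: M).
Proof.
move=> sMG [UA dA]; split=> [|i i' /dA dii'].
  by rewrite -big_distrl /= UA; apply/setIidPr.
exact: disjointWl (subsetIl _ _) (disjointWr (subsetIl _ _) dii').
Qed.

Lemma allocationU (n : nat) (T : finType) (G H : {set T})
    (A D : 'I_n -> {set T}) :
  [disjoint G & H] -> allocation G A -> allocation H D ->
  allocation (G :|: H) (fun i => A i :|: D i).
Proof.
move=> dGH [UA dA] [UD dD]; split=> [|i i' ne_ii'].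
  by rewrite big_split /= UA UD.
have sA k : A k \subset G by rewrite -UA (bigcup_sup k).
have sD k : D k \subset H by rewrite -UD (bigcup_sup k).
have dAD k k' : A k :&: D k' = set0.
  exact/disjoint_setI0/(disjointWl (sA k))/(disjointWr (sD k')).
rewrite -setI_eq0 setIUl !setIUr [D i :&: A i']setIC !dAD set0U setU0 setU_eq0.
by rewrite !setI_eq0 dA ?dD.
Qed.

(** Any prescribed bundle sizes that add up to [#|G|] can be realised. Induction on [#|G|]: some
    good [j] goes to an agent [i0] with positive quota, and the remaining goods are distributed with
    that quota lowered by one. *)
Lemma allocation_of_cards (n : nat) (T : finType) (G : {set T})
    (c : 'I_n -> nat) :
  (\sum_(i < n) c i)%N = #|G| ->
  exists2 D : 'I_n -> {set T}, allocation G D & forall i, #|D i| = c i.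
Proof.
move: {2}#|G| (erefl #|G|) => m; elim: m G c => [|m IHm] G c cardG sum_c.
  exists (fun=> set0) => [|i].
    split=> [|i i' _]; last by rewrite -setI_eq0 setI0.
    by rewrite big1 //; apply/esym/cards0_eq.
  rewrite cards0; apply/esym/eqP.
  by move/eqP: sum_c; rewrite cardG sum_nat_eq0 => /forallP/(_ i).
have /card_gt0P[j jG]: (0 < #|G|)%N by rewrite cardG.
have [i0 c_gt0]: exists i, (0 < c i)%N.
  apply/existsP; rewrite -[[exists _, _]]negbK negb_exists; apply/negP.
  move/forallP=> c0; move: sum_c; rewrite cardG big1 // => i _.
  by apply/eqP; rewrite -leqn0 leqNgt c0.
(* The boolean is read as 0 or 1, so only the quota of [i0] drops; it is positive, hence nothing is
   truncated. *)
pose c' i := (c i - (i == i0))%N.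
have cardG' : #|G :\ j| = m by rewrite (cardsD1 j) jG in cardG; case: cardG.
have sum_c' : (\sum_(i < n) c' i)%N = #|G :\ j|.
  rewrite cardG'; move: sum_c; rewrite cardG.
  rewrite (bigD1 i0) //= (bigD1 i0 (F := c')) //= {1}/c' eqxx.
  case: (c i0) c_gt0 => // k _; rewrite subn1 /= addSn => -[<-].
  by congr addn; apply: eq_bigr => i /negbTE; rewrite /c' => ->; rewrite subn0.
have [D [UD dD] cardD] := IHm _ _ cardG' sum_c'.
have jD i : j \notin D i.
  apply/negP=> jDi; have: j \in G :\ j by rewrite -UD; apply/bigcupP; exists i.
  by rewrite !inE eqxx.
exists (fun i => if i == i0 then j |: D i else D i) => [|i].
  split=> [|i i' ne_ii'].
    rewrite (bigD1 i0) //= eqxx -setUA -[RHS](setD1K jG) -UD.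
    rewrite [in RHS](bigD1 i0) //=; congr (_ |: (_ :|: _)).
    by apply: eq_bigr => i /negbTE->.
  have := dD _ _ ne_ii'; rewrite -!setI_eq0 => /eqP dii'; apply/eqP/setP => k.
  move/setP/(_ k): dii'; have := jD i; have := jD i'; move: ne_ii'.
  case: (eqVneq i i0) => [->|_]; case: (eqVneq i' i0) => [->|_];
    rewrite ?eqxx // !inE // => _;
    by case: (eqVneq k j) => // -> /negbTE-> /negbTE->.
have := cardD i; rewrite /c'; case: eqVneq => [->|_]; last by rewrite subn0.
by rewrite cardsU1 jD => ->; rewrite subn1 add1n prednK.
Qed.

Section DummyGoods.

Variables (R : realFieldType) (n : nat) (T : finType) (M M' : {set T}).
Hypotheses (n_gt0 : (0 < n)%N) (disjMM' : [disjoint M & M']).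
Hypothesis cardM' : #|M'| = (#|M| * (n - 1))%N.

(** A balanced bundle thus has exactly [#|M|] goods, the most that one agent can receive from
    [M]. *)
Let card_goods : #|M :|: M'| = (n * #|M|)%N.
Proof.
rewrite cardsU disjoint_setI0 // cards0 subn0 cardM'.
by rewrite -{1}[#|M|]muln1 -mulnDr subnKC // mulnC.
Qed.

Lemma balanced_extension (B : 'I_n -> {set T}) :
  allocation M B ->
  exists2 D : 'I_n -> {set T},
    allocation M' D & balanced_allocation (M :|: M') (fun i => B i :|: D i).
Proof.
move=> alB; have [UB _] := alB.
have sB i : B i \subset M by rewrite -UB (bigcup_sup i).
have leB i : (#|B i| <= #|M|)%N by apply: subset_leq_card.
have [|D alD cardD] := @allocation_of_cards n T M' (fun i => #|M| - #|B i|)%N.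
  (* Adding [#|M|], written as the sum of the [#|B i|], to both sides turns each summand into [#|M|]
     and removes the truncated subtraction. *)
  apply/eqP; rewrite -(eqn_add2r #|M|) -{2}(card_allocation alB) -big_split /=.
  rewrite (eq_bigr (fun=> #|M|)) => [|i _]; last by rewrite subnK.
  rewrite sum_nat_const card_ord -card_goods cardsU disjoint_setI0 //.
  by rewrite cards0 subn0 addnC.
exists D => //; split=> [|i]; first exact: allocationU.
have sD : D i \subset M' by case: alD => <- _; rewrite (bigcup_sup i).
have dBD : [disjoint B i & D i] by apply: disjointWl (sB i) (disjointWr sD _).
by rewrite cardsU disjoint_setI0 // cards0 subn0 cardD subnKC.
Qed.

(** Agent [i] is short of [#|M|] by [s i], the sum of [1 - x i j] over [M]. Every dummy good is
    split in the same way, agent [i] receiving the share [s i / #|M'|]. *)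
Lemma balanced_frac_extension (x : 'I_n -> T -> R) :
  frac_allocation M x ->
  exists2 y : 'I_n -> T -> R,
    (forall i j, j \in M -> y i j = x i j) &
    balanced_frac_allocation (M :|: M') y.
Proof.
case=> x_ge0 sum_x.
have x_le1 i j : j \in M -> x i j <= 1.
  move=> jM; rewrite -(sum_x j jM) (bigD1 i) //= lerDl.
  by apply: sumr_ge0 => k _; apply: x_ge0.
pose s i : R := \sum_(j in M) (1 - x i j).
have s_ge0 i : 0 <= s i by apply: sumr_ge0 => j jM; rewrite subr_ge0 x_le1.
(* Each good of [M] contributes [n - 1] to the total shortage, since its shares add up to 1. *)
have sum_s : \sum_(i < n) s i = #|M'|%:R.
  rewrite exchange_big /= (eq_bigr (fun=> (n - 1)%:R)) => [|j jM].
    by rewrite sumr_const -mulrnA mulnC -cardM'.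
  by rewrite sumrB sum_x // sumr_const card_ord natrB.
have M'F j : j \in M' -> (j \in M) = false.
  exact: disjointFl disjMM'.
exists (fun i j => if j \in M then x i j else s i / #|M'|%:R) => [i j ->//|].
split; [split=> [i j _|j] | move=> i].
- by case: ifP => [|_]; [apply: x_ge0 | rewrite divr_ge0].
- rewrite inE; case: (boolP (j \in M)) => [jM _|_ jM']; first exact: sum_x.
  rewrite -mulr_suml sum_s divff // pnatr_eq0 -lt0n.
  by apply/card_gt0P; exists j.
(* The required row sum becomes [#|M|]; the row splits into its part over [M] and the dummy part,
   which amounts to [s i]. *)
rewrite card_goods natrM [RHS]mulrC mulKf ?pnatr_eq0 -?lt0n //.
rewrite (eq_bigl [predU M & M']) ?bigU //= => [|j]; last by rewrite !inE.
rewrite (eq_bigr (x i)) => [|j ->//].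
rewrite [X in _ + X](eq_bigr (fun=> s i / #|M'|%:R)) => [|j /M'F-> //].
rewrite sumr_const -[X in _ + X]mulr_natr (_ : s i / _ * _ = s i).
  by rewrite /s sumrB sumr_const addrC subrK.
(* Without dummy goods (n = 1) every [s i] is 0, as is [_ / #|M'|%:R]. *)
have [M'0|M'n0] := eqVneq (#|M'|%:R : R) 0; last by rewrite divfK.
rewrite M'0 mulr0; apply/esym/le_anti; rewrite s_ge0 andbT -M'0 -sum_s.
by rewrite (bigD1 i) //= lerDl sumr_ge0.
Qed.

Variables v v' : 'I_n -> T -> R.
Hypothesis value_dummy : forall (i : 'I_n) (X : {set T}),
  X \subset M :|: M' -> value v' i X = value v i (X :&: M).

(** Applied to singletons, [value_dummy] shows that [v'] agrees with [v] on [M] and vanishes on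
    [M']. *)
Lemma frac_value_dummy (x y : 'I_n -> T -> R) (i : 'I_n) :
  (forall j, j \in M -> x i j = y i j) ->
  frac_value (M :|: M') v' x i = frac_value M v y i.
Proof.
move=> eq_xy; rewrite /frac_value (eq_bigl [predU M & M']) => [|j]; last first.
  by rewrite !inE.
rewrite bigU //=.
have v'E j : j \in M :|: M' -> v' i j = value v i ([set j] :&: M).
  by move=> jG; rewrite -value_dummy ?sub1set // /value big_set1.
rewrite [X in _ + X]big1 ?addr0 => [|j jM'].
  apply: eq_bigr => j jM; rewrite eq_xy // v'E ?inE ?jM //.
  by rewrite (setIidPl _) ?sub1set // /value big_set1.
rewrite v'E ?inE ?jM' ?orbT // disjoint_setI0.
  by rewrite /value big_set0 mul0r.
by rewrite disjoints1 (disjointFl disjMM').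
Qed.

(** Agreement is asked on [M] only, so that the same equivalence serves for restricting to [M] and
    for extending by dummy goods. *)
Lemma dominates_dummy (x x' y y' : 'I_n -> T -> R) :
  (forall i j, j \in M -> x i j = y i j) ->
  (forall i j, j \in M -> x' i j = y' i j) ->
  dominates (M :|: M') v' x x' <-> dominates M v y y'.
Proof.
move=> eq_xy eq_x'y'; rewrite /dominates.
have E i := frac_value_dummy (eq_xy i).
have E' i := frac_value_dummy (eq_x'y' i).
split=> -[le [i lt]]; split.
- by move=> k; rewrite -E -E'.
- by exists i; rewrite -E -E'.
- by move=> k; rewrite E E'.
- by exists i; rewrite E E'.
Qed.

End DummyGoods.

Theorem theorem2 (R : realFieldType) (n : nat) (T : finType) (M M' : {set T})
    (v v' : 'I_n -> T -> R)
    (hn : (0 < n)%N)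
    (hM : M != set0)
    (hv : forall (i : 'I_n) (j : T), j \in M -> 0 <= v i j)
    (hdisj : [disjoint M & M'])
    (hcard : #|M'| = (#|M| * (n - 1))%N)
    (hv' : forall (i : 'I_n) (X : {set T}), X \subset M :|: M' ->
             value v' i X = value v i (X :&: M)) :
  (forall A D : 'I_n -> {set T},
     allocation M A ->
     allocation M' D ->
     balanced_allocation (M :|: M') (fun i => A i :|: D i) ->
     (PO M v A -> balanced_PO (M :|: M') v' (fun i => A i :|: D i)) /\
     (fPO M v A -> balanced_fPO (M :|: M') v' (fun i => A i :|: D i)) /\
     (EF1 v A -> EF1 v' (fun i => A i :|: D i))) /\
  (forall A' : 'I_n -> {set T},
     balanced_allocation (M :|: M') A' ->
     allocation M (fun i => A' i :&: M) /\
     (balanced_PO (M :|: M') v' A' -> PO M v (fun i => A' i :&: M)) /\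
     (balanced_fPO (M :|: M') v' A' -> fPO M v (fun i => A' i :&: M)) /\
     (EF1 v' A' -> EF1 v (fun i => A' i :&: M))).
Proof.
split=> [A D alA alD [alAD _]|A' [alA' _]].
  have sA i : A i \subset M by case: alA => <- _; rewrite (bigcup_sup i).
  have sD i : D i \subset M'.
    by case: alD => <- _; rewrite (bigcup_sup i).
  have AD_M i : (A i :|: D i) :&: M = A i.
    rewrite setIUl (setIidPl (sA i)) disjoint_setI0 ?setU0 // disjoint_sym.
    exact: disjointWr (sD i) hdisj.
  have AD_matrix i j : j \in M ->
      matrix_of R (fun i => A i :|: D i) i j = matrix_of R A i j.
    by move=> jM; rewrite /matrix_of -[in RHS](AD_M i) [in RHS]inE jM andbT.
  have sAD i : A i :|: D i \subset M :|: M' by rewrite setUSS.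
  split; [|split] =>
    [optA [B [[alB _] domB]] | optA [x [[[x0 x1] _] domx]] | EF1A i i'].
  - apply: optA; exists (fun i => B i :&: M); split.
      exact: allocationI (subsetUl _ _) alB.
    apply: (iffLR (dominates_dummy hdisj hv' _ AD_matrix) domB) => i j jM.
    by rewrite /matrix_of inE jM andbT.
  (* The matrix itself is the witness: restriction to [M] just ignores the other columns. *)
  - apply: optA; exists x; split; last first.
      exact: (iffLR (dominates_dummy hdisj hv' _ AD_matrix) domx).
    by split=> [i j jM|j jM]; [apply: x0 | apply: x1]; rewrite inE jM.
  - have [AD0|[j jAD]] := set_0Vmem (A i' :|: D i'); [by left | right].
    have rm k : value v' i ((A i' :|: D i') :\ k) = value v i (A i' :\ k).
      rewrite hv' ?(subset_trans (subsetDl _ _)) //.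
      by rewrite setIDAC AD_M.
    have [A0|[k kA le]] := EF1A i i'; last first.
      by exists k; rewrite ?inE ?kA // rm hv' // AD_M.
    (* Here [A i'] is empty, so the bundle of [i'] holds dummy goods only and any of them can be
       removed: what is left is worth 0. *)
    exists j => //; rewrite rm hv' // AD_M A0 set0D /value big_set0.
    by apply: sumr_ge0 => k /(subsetP (sA i)) /hv.
have alM := allocationI (subsetUl M M') alA'.
have sA' i : A' i \subset M :|: M'.
  by case: alA' => <- _; rewrite (bigcup_sup i).
have A'_matrix i j : j \in M ->
    matrix_of R A' i j = matrix_of R (fun i => A' i :&: M) i j.
  by move=> jM; rewrite /matrix_of inE jM andbT.
split=> //; split; [|split] =>
    [optA' [B [alB domB]] | optA' [x [frx domx]] | EF1A' i i'].
- have [D alD bBD] := balanced_extension hn hdisj hcard alB.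
  apply: optA'; exists (fun i => B i :|: D i); split=> //.
  apply: (iffRL (dominates_dummy hdisj hv' _ A'_matrix) domB) => i j jM.
  have /subsetP/(_ j) sD: D i \subset M'.
    by case: alD => <- _; rewrite (bigcup_sup i).
  rewrite /matrix_of inE.
  case: (boolP (j \in D i)) => [/sD|_]; last by rewrite orbF.
  by rewrite (disjointFr hdisj).
- have [y eq_yx y_bal] := balanced_frac_extension hn hdisj hcard frx.
  apply: optA'; exists y; split=> //.
  exact/(dominates_dummy hdisj hv' eq_yx A'_matrix).
- have [A0|[k kA]] := set_0Vmem (A' i' :&: M); [by left | right].
  have [A'0|[j jA']] := EF1A' i i'; first by rewrite A'0 set0I inE in kA.
  rewrite !hv' ?(subset_trans (subsetDl _ _)) // setIDAC => le.
  (* If [j] is a dummy good, [le] already bounds the value of the whole of [A' i' :&: M], and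
     removing [k] instead lowers that value by [v i k >= 0]. *)
  have [jM|jM] := boolP (j \in M); first by exists j; rewrite ?inE ?jA'.
  exists k => //; apply: le_trans le.
  rewrite [in leRHS](setDidPl _); last first.
    by rewrite disjoint_sym disjoints1 inE (negbTE jM) andbF.
  rewrite [leRHS]/value (big_setD1 k) //= lerDr hv //.
  by case/setIP: kA.
Qed.
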